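(* Let $\mathcal{A}=\mathsf{ISP}(\mathcal{M})$ be a CT-prevariety of structures with associated topological prevariety $\mathcal{A}_{\mathscr{T}}=\mathsf{IS}_{\mathrm c}\mathsf{P}(\mathcal{M}_{\mathscr{T}})$. (i) For each $\mathbf{B}\in\mathcal{A}_{\mathscr{T}}$ there exists a continuous homomorphism $\gamma\colon n_{\mathcal{A}}(\mathbf{B}^\flat)\to\mathbf{B}$ with $\gamma\circ e_{\mathbf{B}^\flat}=\mathrm{id}_B$. (ii) The natural extension functor $n_{\mathcal{A}}\colon\mathcal{A}\to\mathcal{A}_{\mathscr{T}}$ is a reflection of $\mathcal{A}$ into the (non-full) subcategory $\mathcal{A}_{\mathscr{T}}$. Specifically, for each $\mathbf{A}\in\mathcal{A}$, each $\mathbf{B}\in\mathcal{A}_{\mathscr{T}}$ and every homomorphism $g\colon\mathbf{A}\to\mathbf{B}^\flat$, there exists a unique continuous homomorphism $h\colon n_{\mathcal{A}}(\mathbf{A})\to\mathbf{B}$ with $h\circ e_{\mathbf{A}}=g$.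
   Context: A structure $\mathbf{A}=\langle A;G,H,R\rangle$ is a set $A$ with a set $G$ of finitary total operations, a set $H$ of finitary partial operations and a set $R$ of finitary relations. Products are formed coordinatewise (a partial operation is defined at a tuple iff it is defined in every coordinate); a substructure is a subset closed under the operations and under the partial operations where defined, with restricted structure; homomorphisms preserve operations, relations and partial operations (where defined); embeddings are isomorphisms onto substructures. A topology on a structure is compatible with it if the relations and the domains of partial operations are topologically closed and the operations and partial operations are continuous; a topological structure is a structure with a compatible topology. All compact spaces are assumed Hausdorff. CT-prevariety: $\mathcal{M}$ is a set of structures of common signature, each $\mathbf{M}\in\mathcal{M}$ having a fixed associated compact topology $\mathscr{T}$ compatible with $\mathbf{M}$; $\mathbf{M}_{\mathscr{T}}$ denotes $\mathbf{M}$ with this topology and $\mathcal{M}_{\mathscr{T}}=\{\mathbf{M}_{\mathscr{T}}\mid\mathbf{M}\in\mathcal{M}\}$. $\mathcal{A}=\mathsf{ISP}(\mathcal{M})$ is the class of isomorphic copies of non-empty substructures of products of members of $\mathcal{M}$ (morphisms: homomorphisms). $\mathcal{A}_{\mathscr{T}}=\mathsf{IS}_{\mathrm c}\mathsf{P}(\mathcal{M}_{\mathscr{T}})$ is the class of isomorphic copies of non-empty topologically closed substructures of products of members of $\mathcal{M}_{\mathscr{T}}$ (morphisms: continuous homomorphisms). $\mathbf{B}^\flat$ is $\mathbf{B}$ with its topology forgotten. For $\mathbf{A}\in\mathcal{A}$, $X_{\mathbf{A}}$ is the disjoint union of the hom-sets $\mathcal{A}(\mathbf{A},\mathbf{M})$,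 $\mathbf{M}\in\mathcal{M}$; for $x\in\mathcal{A}(\mathbf{A},\mathbf{M})$, $\mathbf{Y}_x:=\mathbf{M}_{\mathscr{T}}$. The embedding $e_{\mathbf{A}}\colon\mathbf{A}\to\prod\{\mathbf{Y}_x\mid x\in X_{\mathbf{A}}\}$ is $e_{\mathbf{A}}(a)(x):=x(a)$. The natural extension $n_{\mathcal{A}}(\mathbf{A})$ is the smallest topologically closed substructure of $\prod\{\mathbf{Y}_x\mid x\in X_{\mathbf{A}}\}$ containing $e_{\mathbf{A}}(A)$; $e_{\mathbf{A}}$ is also regarded as a map into $n_{\mathcal{A}}(\mathbf{A})$. For a homomorphism $u\colon\mathbf{A}\to\mathbf{B}$ in $\mathcal{A}$, $n_{\mathcal{A}}(u)\colon n_{\mathcal{A}}(\mathbf{A})\to n_{\mathcal{A}}(\mathbf{B})$ is given by $n_{\mathcal{A}}(u)(f)(y):=f(y\circ u)$ for $y\in X_{\mathbf{B}}$. *)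

(* Defs.v *)
From HB Require Import structures.
From mathcomp Require Import all_boot.
From mathcomp Require Import all_classical topology.

Set Implicit Arguments.
Unset Strict Implicit.
Unset Printing Implicit Defensive.

(* Puts the product topology on ['I_n -> A] and [forall i, T i]. *)
Import ArrowAsProduct.
Local Open Scope classical_set_scope.

Record signature := Signature {
  opsym : Type; op_ar : opsym -> nat;
  popsym : Type; pop_ar : popsym -> nat;
  relsym : Type; rel_ar : relsym -> nat }.

(* [pop_on p] is a total function on the subtype of tuples in its domain. *)
Record structure_on (S : signature) (A : Type) := StructureOn {
  op_on : forall o : opsym S, ('I_(op_ar o) -> A) -> A;
  dom_on : forall p : popsym S, set ('I_(pop_ar p) -> A);
  pop_on : forall p : popsym S, @dom_on p -> A;
  rel_on : forall r : relsym S, set ('I_(rel_ar r) -> A) }.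

Arguments op_on {S A} s o.
Arguments dom_on {S A} s p.
Arguments pop_on {S A} s p.
Arguments rel_on {S A} s r.

Record structure (S : signature) := Structure {
  carrier :> Type;
  structure_of : structure_on S carrier }.

Definition op (S : signature) (A : structure S) := op_on (structure_of A).
Definition dom (S : signature) (A : structure S) := dom_on (structure_of A).
Definition pop (S : signature) (A : structure S) := pop_on (structure_of A).
Definition rel (S : signature) (A : structure S) := rel_on (structure_of A).

Arguments op {S A} o.
Arguments dom {S} A p.
Arguments pop {S A} p.
Arguments rel {S A} r.

Lemma pop_ext (S : signature) (A : structure S) p (t t' : dom A p) :
  sval t = sval t' -> pop p t = pop p t'.
Proof. by move=> e; congr pop; exact: val_inj. Qed.

Record compatible (S : signature) (T : topologicalType)
    (s : structure_on S T) : Prop := Compatible {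
  op_continuous : forall o, continuous (op_on s o);
  dom_closed : forall p, closed (dom_on s p);
  pop_continuous : forall p, continuous (pop_on s p);
  rel_closed : forall r, closed (rel_on s r) }.

Record tstructure (S : signature) := TStructure {
  space :> topologicalType;
  tstructure_of : structure_on S space;
  tstructure_compatible : compatible tstructure_of }.

Definition flat (S : signature) (B : tstructure S) : structure S :=
  Structure (tstructure_of B).

(* [hom_pop]: [f \o t] lies in the domain of [p] whenever [t] does. *)
Record is_hom (S : signature) (A B : structure S) (f : A -> B) : Prop := IsHom {
  hom_op : forall o (t : 'I_(op_ar o) -> A), f (op o t) = op o (f \o t);
  hom_rel : forall r (t : 'I_(rel_ar r) -> A), rel r t -> rel r (f \o t);
  hom_pop : forall p (t : dom A p),
    exists2 t' : dom B p, sval t' = f \o sval t & f (pop p t) = pop p t' }.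

Record hom (S : signature) (A B : structure S) := Hom {
  hom_fun :> A -> B;
  homP : is_hom hom_fun }.

Record chom (S : signature) (A B : tstructure S) := CHom {
  chom_hom :> hom (flat A) (flat B);
  chom_continuous : continuous (chom_hom : A -> B) }.

Definition iso (S : signature) (A B : structure S) : Prop :=
  exists (f : hom A B) (g : hom B A), cancel f g /\ cancel g f.

Definition tiso (S : signature) (A B : tstructure S) : Prop :=
  exists (f : chom A B) (g : chom B A), cancel f g /\ cancel g f.

Lemma id_is_hom (S : signature) (A : structure S) : is_hom (@id A).
Proof. by split=> // p t; exists t. Qed.

Definition idhom (S : signature) (A : structure S) : hom A A :=
  Hom (@id_is_hom S A).

Lemma comp_is_hom (S : signature) (A B C : structure S)
  (g : hom B C) (f : hom A B) : is_hom (g \o f).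
Proof.
split.
- by move=> o t; rewrite /= (hom_op (homP f)) (hom_op (homP g)).
- by move=> r t /(hom_rel (homP f)) /(hom_rel (homP g)).
- move=> p t /=; have [t1 e1 ->] := hom_pop (homP f) t.
  have [t2 e2 ->] := hom_pop (homP g) t1; exists t2 => //.
  by rewrite e2 e1.
Qed.

Definition comphom (S : signature) (A B C : structure S)
  (g : hom B C) (f : hom A B) : hom A C := Hom (comp_is_hom g f).

Lemma id_chom_continuous (S : signature) (B : tstructure S) :
  continuous (idhom (flat B) : B -> B).
Proof. by move=> x. Qed.

Definition idchom (S : signature) (B : tstructure S) : chom B B :=
  CHom (@id_chom_continuous S B).

Lemma comp_chom_continuous (S : signature) (A B C : tstructure S)
  (g : chom B C) (f : chom A B) : continuous (comphom g f : A -> C).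
Proof.
move=> x; apply: (@continuous_comp A B C f g).
- exact: chom_continuous.
- exact: chom_continuous.
Qed.

Definition compchom (S : signature) (A B C : tstructure S)
  (g : chom B C) (f : chom A B) : chom A C :=
  CHom (@comp_chom_continuous S A B C g f).

Section Product.
Context {S : signature} {I : Type}.

Definition coord (A : I -> Type) (n : nat) (t : 'I_n -> forall i, A i)
  (i : I) : 'I_n -> A i := fun k => t k i.

Definition prod_dom (M : I -> structure S) (p : popsym S) :
    set ('I_(pop_ar p) -> forall i, M i) :=
  [set t | forall i, dom (M i) p (coord t i)].

Definition prod_on (M : I -> structure S) : structure_on S (forall i, M i) :=
  {| op_on := fun o t i => op o (coord t i);
     dom_on := @prod_dom M;
     pop_on := fun p (t : @prod_dom M p) i =>
       pop p (exist _ (coord (sval t) i) (mem_set (set_mem (svalP t) i)));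
     rel_on := fun r => [set t | forall i, rel r (coord t i)] |}.

Definition prod_structure (M : I -> structure S) : structure S :=
  Structure (prod_on M).

Lemma continuous_prod (X : topologicalType) (T : I -> topologicalType)
  (f : X -> forall i, T i) :
  (forall i, continuous (fun x => f x i)) -> continuous f.
Proof.
move=> cf x; apply/cvg_sup => i.
exact: (@continuous_comp_initial _ X _
  (fun h : forall i, T i => h i) f (cf i)).
Qed.

Lemma continuous_proj (T : I -> topologicalType) (i : I) :
  continuous (fun f : forall i, T i => f i).
Proof. exact: (@proj_continuous {classic I} T i). Qed.

End Product.

Lemma continuous_coord (I : Type) (T : I -> topologicalType) (n : nat) (i : I) :
  continuous (fun t : 'I_n -> forall i, T i => coord t i).
Proof.
apply: continuous_prod => k t.
apply: (@continuous_comp ('I_n -> forall i, T i) (forall i, T i) (T i)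
  (fun t => t k) (fun f => f i)).
- exact: (@continuous_proj _ (fun=> forall i, T i) k).
- exact: continuous_proj.
Qed.

Lemma continuous_sval (T : topologicalType) (D : set T) :
  continuous (sval : D -> T).
Proof. exact: (@initial_continuous D T (@set_val T D)). Qed.

Lemma continuous_to_sub (X T : topologicalType) (D : set T) (f : X -> D) :
  continuous (sval \o f) -> continuous f.
Proof. exact: (@continuous_comp_initial _ X T (@set_val T D) f). Qed.

Lemma prod_compatible (S : signature) (I : Type) (M : I -> tstructure S) :
  compatible (prod_on (fun i => flat (M i)) : structure_on S (forall i, M i)).
Proof.
split.
- move=> o; apply: continuous_prod => i t.
  apply: (@continuous_comp _ _ _ (fun t => coord t i)
    (op_on (tstructure_of (M i)) o)).
  + exact: continuous_coord.
  + exact: (op_continuous (tstructure_compatible (M i))).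
- move=> p; rewrite (_ : dom_on _ p = \bigcap_i
    ((fun t : 'I_(pop_ar p) -> forall i, M i => coord t i) @^-1`
      dom_on (tstructure_of (M i)) p)); last first.
    by apply/seteqP; split => t /= h i; [move=> _|]; apply: h.
  apply: closed_bigI => i _; have [_ /(_ p) + _ _] := tstructure_compatible (M i).
  exact: (iffLR (continuous_closedP _) (@continuous_coord _ _ _ i)).
- move=> p; apply: continuous_prod => i t.
  pose D : set ('I_(pop_ar p) -> forall i, M i) :=
      @prod_dom _ _ (fun i => flat (M i)) p.
  pose c (t : D) : dom_on (tstructure_of (M i)) p :=
    exist _ (coord (sval t) i) (mem_set (set_mem (svalP t) i)).
  apply: (@continuous_comp _ _ _ c (pop_on (tstructure_of (M i)) p)).
  + apply: continuous_to_sub => {}t.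
    apply: (@continuous_comp D ('I_(pop_ar p) -> forall i, M i) _ sval
      (fun t => coord t i)).
    * exact: continuous_sval.
    * exact: continuous_coord.
  + exact: (pop_continuous (tstructure_compatible (M i))).
- move=> r; rewrite (_ : rel_on _ r = \bigcap_i
    ((fun t : 'I_(rel_ar r) -> forall i, M i => coord t i) @^-1`
      rel_on (tstructure_of (M i)) r)); last first.
    by apply/seteqP; split => t /= h i; [move=> _|]; apply: h.
  apply: closed_bigI => i _; have [_ _ _ /(_ r)] := tstructure_compatible (M i).
  exact: (iffLR (continuous_closedP _) (@continuous_coord _ _ _ i)).
Qed.

Definition prod_tstructure (S : signature) (I : Type) (M : I -> tstructure S) :
  tstructure S := TStructure (prod_compatible M).

Record substructure (S : signature) (A : structure S) (D : set A) : Prop :=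
  Substructure {
    sub_op_closed : forall o (t : 'I_(op_ar o) -> A),
      (forall k, D (t k)) -> D (op o t);
    sub_pop_closed : forall p (t : dom A p),
      (forall k, D (sval t k)) -> D (pop p t) }.

Lemma preimage_substructure (S : signature) (A B : structure S) (f : hom A B)
  (D : set B) : substructure D -> substructure (f @^-1` D).
Proof.
move=> HD; split.
- by move=> o t Dt; rewrite /= (hom_op (homP f)); apply: (sub_op_closed HD).
- move=> p t Dt /=; have [t' e ->] := hom_pop (homP f) t.
  by apply: (sub_pop_closed HD) => k; rewrite e; exact: Dt.
Qed.

Section Substructure.
Context {S : signature} {A : structure S} {D : set A} (HD : substructure D).

Definition incl (n : nat) (t : 'I_n -> D) : 'I_n -> A := fun k => sval (t k).

Lemma inclP (n : nat) (t : 'I_n -> D) k : D (incl t k).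
Proof. exact: set_mem (svalP (t k)). Qed.

Definition sub_dom (p : popsym S) : set ('I_(pop_ar p) -> D) :=
  [set t | dom A p (incl t)].

Definition sub_dom_incl (p : popsym S) (t : @sub_dom p) : dom A p :=
  exist _ (incl (sval t)) (mem_set (set_mem (svalP t))).

Definition sub_on : structure_on S D :=
  {| op_on := fun o t =>
       exist _ (op o (incl t)) (mem_set (sub_op_closed HD (inclP t)));
     dom_on := @sub_dom;
     pop_on := fun p (t : @sub_dom p) =>
       exist _ (pop p (sub_dom_incl t))
         (mem_set (sub_pop_closed HD
           (inclP (sval t) : forall k, D (sval (sub_dom_incl t) k))));
     rel_on := fun r => [set t | rel r (incl t)] |}.

Definition sub_structure : structure S := Structure sub_on.

End Substructure.

Lemma continuous_incl (T : topologicalType) (D : set T) (n : nat) :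
  continuous (fun (t : 'I_n -> D) (k : 'I_n) => sval (t k)).
Proof.
apply: continuous_prod => k t.
apply: (@continuous_comp ('I_n -> D) D T (fun t => t k) sval).
- exact: (@continuous_proj _ (fun=> D : topologicalType) k).
- exact: continuous_sval.
Qed.

Lemma sub_compatible (S : signature) (B : tstructure S) (D : set B)
  (HD : substructure (D : set (flat B))) :
  compatible (sub_on HD : structure_on S (D : topologicalType)).
Proof.
have [cop cdom cpop crel] := tstructure_compatible B.
split.
- move=> o; apply: continuous_to_sub => t.
  apply: (@continuous_comp _ _ _ (fun (t : 'I_(op_ar o) -> D) k => sval (t k))
    (op_on (tstructure_of B) o)).
  + exact: continuous_incl.
  + exact: cop.
- move=> p; move: (cdom p).
  exact: (iffLR (continuous_closedP _) (@continuous_incl _ D _)).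
- move=> p; apply: continuous_to_sub => t.
  apply: (@continuous_comp _ _ _
    (@sub_dom_incl S (flat B) D p : _ -> dom_on (tstructure_of B) p)
    (pop_on (tstructure_of B) p)); last exact: cpop.
  apply: continuous_to_sub => {}t.
  pose E : set ('I_(pop_ar p) -> D) := @sub_dom S (flat B) D p.
  apply: (@continuous_comp E ('I_(pop_ar p) -> D) ('I_(pop_ar p) -> B) sval
    (fun t k => sval (t k))).
  + exact: continuous_sval.
  + exact: continuous_incl.
- move=> r; move: (crel r).
  exact: (iffLR (continuous_closedP _) (@continuous_incl _ D _)).
Qed.

Definition sub_tstructure (S : signature) (B : tstructure S) (D : set B)
  (HD : substructure (D : set (flat B))) : tstructure S :=
  TStructure (sub_compatible HD).

Section Prevariety.
Context {S : signature} {J : Type} (M : J -> tstructure S).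

(* A set of structures is given as a family indexed by [J], repetitions being
   allowed; each [phi : I -> J] selects the factors of a product, and [I] may be
   empty. *)
Definition ISP (A : structure S) : Prop :=
  exists (I : Type) (phi : I -> J)
    (D : set (prod_structure (fun i => flat (M (phi i)))))
    (HD : substructure D),
    D !=set0 /\ iso A (sub_structure HD).

Definition IScP (B : tstructure S) : Prop :=
  exists (I : Type) (phi : I -> J)
    (D : set (prod_tstructure (fun i => M (phi i))))
    (HD : substructure (D : set (flat (prod_tstructure _)))),
    [/\ closed D, D !=set0 & tiso B (sub_tstructure HD)].

Definition homset (A : structure S) : Type := {j : J & hom A (flat (M j))}.

Definition hom_prod (A : structure S) : tstructure S :=
  prod_tstructure (fun x : homset A => M (projT1 x)).

Definition evaluation (A : structure S) (a : A) : hom_prod A :=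
  fun x => projT2 x a.

Definition natext_set (A : structure S) : set (hom_prod A) :=
  smallest
    (fun D => closed D /\ substructure (D : set (flat (hom_prod A))))
    (range (@evaluation A)).

Lemma natext_substructure (A : structure S) :
  substructure (@natext_set A : set (flat (hom_prod A))).
Proof.
split.
- move=> o t Dt D HD; apply: (sub_op_closed HD.1.2) => k; exact: Dt.
- move=> p t Dt D HD; apply: (sub_pop_closed HD.1.2) => k; exact: Dt.
Qed.

Definition natext (A : structure S) : tstructure S :=
  sub_tstructure (natext_substructure A).

Lemma natext_evaluation (A : structure S) (a : A) :
  @natext_set A (evaluation a).
Proof. by apply: sub_gen_smallest; exists a. Qed.

Definition unit_fun (A : structure S) (a : A) : flat (natext A) :=
  exist _ (evaluation a) (mem_set (natext_evaluation a)).

Lemma unit_is_hom (A : structure S) : is_hom (@unit_fun A).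
Proof.
split.
- move=> o t; apply: eq_exist; apply: functional_extensionality_dep => x /=.
  exact: (hom_op (homP (projT2 x))).
- by move=> r t rt x; exact: (hom_rel (homP (projT2 x)) rt).
- move=> p t.
  have h : dom (flat (natext A)) p (@unit_fun A \o sval t).
    move=> x; have [t' e _] := hom_pop (homP (projT2 x)) t.
    by have := set_mem (svalP t'); rewrite e.
  exists (exist _ (@unit_fun A \o sval t) (mem_set h)) => //.
  apply: eq_exist; apply: functional_extensionality_dep => x /=.
  have [t' e' E'] := hom_pop (homP (projT2 x)) t.
  apply: (etrans E'); apply: (@pop_ext _ (flat (M (projT1 x))) p); exact: e'.
Qed.

Definition unit_hom (A : structure S) : hom A (flat (natext A)) :=
  Hom (@unit_is_hom A).

Definition precomp (A B : structure S) (u : hom A B) (y : homset B) : homset A :=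
  existT _ (projT1 y) (comphom (projT2 y) u).

Definition prod_map (A B : structure S) (u : hom A B) (f : hom_prod A) :
  hom_prod B := fun y => f (precomp u y).

Lemma prod_map_is_hom (A B : structure S) (u : hom A B) :
  @is_hom S (flat (hom_prod A)) (flat (hom_prod B)) (prod_map u).
Proof.
split=> //.
- by move=> r t rt y; exact: (rt (precomp u y)).
- move=> p t.
  have h : dom (flat (hom_prod B)) p (prod_map u \o sval t).
    by move=> y; exact: (set_mem (svalP t) (precomp u y)).
  exists (exist _ (prod_map u \o sval t) (mem_set h)) => //.
  apply: functional_extensionality_dep => y /=.
  by rewrite /prod_map; apply: (@pop_ext _ (flat (M (projT1 y))) p).
Qed.

Definition prod_map_hom (A B : structure S) (u : hom A B) :
  hom (flat (hom_prod A)) (flat (hom_prod B)) := Hom (prod_map_is_hom u).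

Lemma prod_map_continuous (A B : structure S) (u : hom A B) :
  continuous (prod_map u : hom_prod A -> hom_prod B).
Proof.
apply: continuous_prod => y.
exact: (@continuous_proj _ (fun x : homset A => M (projT1 x)) (precomp u y)).
Qed.

Lemma prod_map_natext (A B : structure S) (u : hom A B) (f : hom_prod A) :
  natext_set f -> natext_set (prod_map u f).
Proof.
move=> Nf D [[cD sD] eD]; apply: (Nf (prod_map u @^-1` D)); split; first split.
- exact: (iffLR (continuous_closedP _) (@prod_map_continuous _ _ u)).
- exact: (@preimage_substructure _ _ _ (prod_map_hom u) D sD).
- by move=> _ [a _ <-]; apply: eD; exists (u a).
Qed.

Definition natext_fun (A B : structure S) (u : hom A B) (f : natext A) :
  natext B := exist _ (prod_map u (sval f))
    (mem_set (prod_map_natext u (set_mem (svalP f)))).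

Lemma natext_fun_is_hom (A B : structure S) (u : hom A B) :
  @is_hom S (flat (natext A)) (flat (natext B)) (natext_fun u).
Proof.
have [ho hr hp] := prod_map_is_hom u.
split.
- by move=> o t; exact: eq_exist.
- by move=> r t; exact: hr.
- move=> p t.
  have h : dom (flat (natext B)) p (natext_fun u \o sval t).
    by move=> y; exact: (set_mem (svalP t) (precomp u y)).
  exists (exist _ (natext_fun u \o sval t) (mem_set h)) => //.
  apply: eq_exist; apply: functional_extensionality_dep => y /=.
  by rewrite /prod_map; apply: (@pop_ext _ (flat (M (projT1 y))) p).
Qed.

Lemma natext_fun_continuous (A B : structure S) (u : hom A B) :
  continuous (natext_fun u : natext A -> natext B).
Proof.
apply: continuous_to_sub => f.
apply: (@continuous_comp (natext A) (hom_prod A) (hom_prod B) sval (prod_map u)).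
- exact: continuous_sval.
- exact: prod_map_continuous.
Qed.

Definition natext_hom (A B : structure S) (u : hom A B) :
  chom (natext A) (natext B) :=
  @CHom S (natext A) (natext B) (Hom (natext_fun_is_hom u))
    (@natext_fun_continuous A B u).

End Prevariety.

(* Main.v *)
(* An object [B] of [IScP M] embeds in a product of members of [M], and the
   coordinates of [B] in it are homomorphisms to members of [M]. Composed with
   [g : A -> B] they are elements of [homset M A], so projecting [hom_prod M A]
   onto these coordinates is a continuous homomorphism extending [g]; it sends
   the natural extension into the closed substructure [B], because the preimage
   of [B] is a closed substructure containing the image of [A]. Part (i) is the
   case [g = id]. Uniqueness holds because the equalizer of two continuous
   homomorphisms to a Hausdorff structure is a closed substructure. *)
Require Import Defs.
From mathcomp Require Import all_boot.
From mathcomp Require Import all_classical topology.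

Set Implicit Arguments.
Unset Strict Implicit.
Unset Printing Implicit Defensive.

Local Open Scope classical_set_scope.

(** * Equality of morphisms, and closed sets *)

Lemma hom_ext (S : signature) (A B : structure S) (f g : hom A B) :
  hom_fun f =1 hom_fun g -> f = g.
Proof.
case: f g => [f hf] [g hg] /= /funext e; rewrite -{}e in hg *.
by congr Hom; exact: Prop_irrelevance.
Qed.

Lemma chom_ext (S : signature) (A B : tstructure S) (f g : chom A B) :
  (forall x, f x = g x) -> f = g.
Proof.
case: f g => [f hf] [g hg] /= fg; have e : f = g by exact: hom_ext.
rewrite -{}e in hg *.
by congr CHom; exact: Prop_irrelevance.
Qed.

Lemma closed_equalizer (X Y : topologicalType) (f g : X -> Y) :
  hausdorff_space Y -> continuous f -> continuous g ->
  closed [set x | f x = g x].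
Proof.
(* In [hausdorff_space] form, it suffices that all neighbourhoods of [f x] and [g x] meet; a point
   [z] of the equalizer close to [x] supplies the common value. *)
move=> hY cf cg x clx; apply: hY => U V /cf fU /cg gV.
have [z [/= fgz [Uz Vz]]] := clx _ (@filterI _ (nbhs x) _ _ _ fU gV).
by exists (f z); split=> //; rewrite fgz.
Qed.

Lemma closed_sval_image (T : topologicalType) (D : set T) (E : set D) :
  closed D -> closed E -> closed (sval @` E).
Proof.
move=> cD cE y cly.
have Dy : D y.
  (* Every neighbourhood of [y] meets the image of [E], hence [D]. *)
  apply: cD => U /cly [_ [[z _ <-] Uz]].
  by exists (sval z); split=> //; exact: set_mem (svalP z).
exists (exist _ y (mem_set Dy)) => //.
(* Neighbourhoods in the subspace contain traces of open sets [W] of [T], so the closure hypothesis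
   can be applied to [W]. *)
apply: cE => U [V [[W oW <-] Wy WU]].
have [_ [[z Ez <-] Wz]] := cly W (open_nbhs_nbhs (conj oW Wy)).
by exists z; split=> //; exact: WU.
Qed.

(** * Homomorphisms for substructures and products *)

Lemma sval_is_hom (S : signature) (A : structure S) (D : set A)
  (HD : substructure D) : is_hom (A := sub_structure HD) (B := A) sval.
Proof. by split=> // p t; exists (sub_dom_incl t). Qed.

Lemma corestrict_is_hom (S : signature) (A B : structure S) (D : set B)
  (HD : substructure D) (f : hom A B) (Df : forall a, D (f a)) :
  is_hom (B := sub_structure HD)
    (fun a => exist (fun b => b \in D) (f a) (mem_set (Df a))).
Proof.
split.
- by move=> o t; apply: eq_exist; exact: (hom_op (homP f)).
- by move=> r t /(hom_rel (homP f)).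
- move=> p t; have [t' e E] := hom_pop (homP f) t.
  pose u k : sub_structure HD :=
    exist _ (f (sval t k)) (mem_set (Df (sval t k))).
  have h : dom (sub_structure HD) p u.
    by have := set_mem (svalP t'); rewrite e.
  exists (exist _ u (mem_set h)) => //.
  by apply: eq_exist; rewrite E; exact: pop_ext.
Qed.

Lemma proj_is_hom (S : signature) (I : Type) (M : I -> structure S) (i : I) :
  is_hom (A := prod_structure M) (B := M i) (fun f => f i).
Proof.
split=> [//|r t /(_ i) //|p t].
by exists (exist _ (coord (sval t) i) (mem_set (set_mem (svalP t) i))).
Qed.

Lemma pairing_is_hom (S : signature) (I : Type) (A : structure S)
  (M : I -> structure S) (f : forall i, hom A (M i)) :
  is_hom (B := prod_structure M) (fun a i => f i a).
Proof.
split.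
- by move=> o t; apply: functional_extensionality_dep => i;
    exact: (hom_op (homP (f i))).
- by move=> r t rt i; exact: (hom_rel (homP (f i)) rt).
- move=> p t.
  pose u k : prod_structure M := fun i => f i (sval t k).
  have h : dom (prod_structure M) p u.
    move=> i; have [t' e _] := hom_pop (homP (f i)) t.
    by have := set_mem (svalP t'); rewrite e.
  exists (exist _ u (mem_set h)) => //.
  apply: functional_extensionality_dep => i /=.
  by have [t' e ->] := hom_pop (homP (f i)) t; exact: pop_ext.
Qed.

(** * Substructures from equalizers and inclusions *)

Lemma equalizer_substructure (S : signature) (A B : structure S)
  (f g : hom A B) : substructure [set a | f a = g a].
Proof.
split.
- move=> o t e /=; rewrite (hom_op (homP f)) (hom_op (homP g)).
  by congr op; apply: funext => k; exact: e.
- move=> p t e /=.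
  have [t1 e1 ->] := hom_pop (homP f) t; have [t2 e2 ->] := hom_pop (homP g) t.
  by apply: pop_ext; rewrite e1 e2; apply: funext => k; exact: e.
Qed.

(** Choice lifts a tuple of the image to one in [E]. Operations and domains of the substructure are
    computed through the inclusion, so the lift can be used in place of the tuple. *)
Lemma sval_image_substructure (S : signature) (A : structure S) (D : set A)
  (HD : substructure D) (E : set (sub_structure HD)) :
  substructure E -> substructure (sval @` E : set A).
Proof.
move=> HE; split.
- move=> o t Et.
  have /choice[u uE] k : exists z : sub_structure HD, E z /\ sval z = t k.
    by have [z Ez <-] := Et k; exists z.
  exists (op (A := sub_structure HD) o u).
    by apply: (sub_op_closed HE) => k; case: (uE k).
  by congr op; apply: funext => k; case: (uE k).
- move=> p t Et.
  have /choice[u uE] k : exists z : sub_structure HD, E z /\ sval z = sval t k.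
    by have [z Ez <-] := Et k; exists z.
  have ut : Defs.incl u = sval t by apply: funext => k; case: (uE k).
  have h : dom (sub_structure HD) p u.
    by have := set_mem (svalP t); rewrite -ut.
  exists (pop (A := sub_structure HD) p (exist _ u (mem_set h))).
    by apply: (sub_pop_closed HE) => k; case: (uE k).
  exact: pop_ext.
Qed.

(** * Universal property of the natural extension *)

Section NaturalExtension.
Context {S : signature} {J : Type} (M : J -> tstructure S).

Lemma closed_natext_set (A : structure S) : closed (@natext_set S J M A).
Proof. by apply: closed_bigI => D [[]]. Qed.

(** Minimality is stated for subsets of the full product, so [E] is pushed forward along the
    inclusion, where it competes with [natext_set]. This replaces a density argument. *)
Lemma natext_ind (A : structure S) (E : set (natext M A)) :
  closed E -> substructure (E : set (flat (natext M A))) ->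
  (forall a, E (unit_hom M A a)) -> forall x, E x.
Proof.
move=> cE sE eE x.
have [|z Ez zx] := set_mem (svalP x) (sval @` E).
  split; first split.
  - exact: closed_sval_image (@closed_natext_set A) cE.
  - exact: (@sval_image_substructure _ _ _ (natext_substructure M A) E sE).
  - by move=> _ [a _ <-]; exists (unit_hom M A a).
by have <- : z = x by exact: val_inj.
Qed.

Lemma natext_extend (A : structure S) (B : tstructure S) :
  IScP M B -> forall g : hom A (flat B),
  exists h : chom (natext M A) B, forall a : A, h (unit_hom M A a) = g a.
Proof.
move=> [I [phi [D [HD [cD _ [f [f' [fK f'K]]]]]]]] g.
pose P := prod_tstructure (fun i => M (phi i)).
pose pr i : hom (flat P) (flat (M (phi i))) :=
  Hom (@proj_is_hom S I (fun i => flat (M (phi i))) i).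
pose inc : hom (sub_structure HD) (flat P) := Hom (sval_is_hom HD).
(* The index of the product over [homset M A] at which evaluation returns the [i]-th coordinate of
   [f (g a)]. *)
pose y i : homset M A :=
  existT _ (phi i) (comphom (pr i) (comphom inc (comphom f g))).
pose G : hom (flat (hom_prod M A)) (flat P) :=
  Hom (@pairing_is_hom S I (flat (hom_prod M A)) (fun i => flat (M (phi i)))
    (fun i => Hom (@proj_is_hom S (homset M A)
                     (fun x => flat (M (projT1 x))) (y i)))).
have cG : continuous (G : hom_prod M A -> P).
  apply: continuous_prod => i.
  exact: (@continuous_proj _ (fun x : homset M A => M (projT1 x)) (y i)).
have DG (x : natext M A) : D (G (sval x)).
  apply: (set_mem (svalP x) (G @^-1` D)); split; first split.
  - exact: (iffLR (continuous_closedP _) cG).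
  - exact: (@preimage_substructure _ _ _ G D HD).
  - by move=> _ [a _ <-]; exact: set_mem (svalP (f (g a))).
pose Gs : hom (flat (natext M A)) (flat P) :=
  comphom G (Hom (sval_is_hom (natext_substructure M A))).
pose k : hom (flat (natext M A)) (flat (sub_tstructure HD)) :=
  Hom (@corestrict_is_hom S _ (flat P) D HD Gs DG).
have ck : continuous (k : natext M A -> sub_tstructure HD).
  apply: continuous_to_sub => x.
  apply: (@continuous_comp (natext M A) (hom_prod M A) P sval G).
  - exact: continuous_sval.
  - exact: cG.
exists (compchom f' (CHom ck)) => a.
have -> : g a = f' (f (g a)) by rewrite fK.
(* [k] at the unit of [a] and [f (g a)] have the same underlying point of [P]. *)
by congr (f' _); exact: val_inj.
Qed.

Lemma natext_unique (M_hausdorff : forall j, hausdorff_space (M j))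
  (A : structure S) (B : tstructure S) (h1 h2 : chom (natext M A) B) :
  IScP M B ->
  (forall a, h1 (unit_hom M A a) = h2 (unit_hom M A a)) -> h1 = h2.
Proof.
move=> [I [phi [D [HD [_ _ [f [f' [fK _]]]]]]]] e; apply: chom_ext.
apply: (@natext_ind A [set x | h1 x = h2 x]) => //; last first.
  exact: equalizer_substructure.
pose c (h : chom (natext M A) B) i x : M (phi i) := sval (f (h x)) i.
have cc h i : continuous (c h i).
  move=> x; apply: (@continuous_comp (natext M A) B _ h
    (fun b => sval (f b) i)); first exact: chom_continuous.
  apply: (@continuous_comp B (sub_tstructure HD) _ f (fun z => sval z i)).
    exact: chom_continuous.
  apply: (@continuous_comp (sub_tstructure HD) (prod_tstructure _) _ sval
    (fun z => z i)); first exact: continuous_sval.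
  exact: (@continuous_proj _ (fun i => M (phi i)) i).
(* Since [f] is injective, [h1] and [h2] agree exactly where all coordinates do; each coordinate
   lands in a Hausdorff [M (phi i)]. *)
rewrite (_ : [set x | _] = \bigcap_i [set x | c h1 i x = c h2 i x]).
  by apply: closed_bigI => i _; exact: closed_equalizer.
apply/seteqP; split=> [x hx i _|x /= cx].
  by congr (sval (f _) i).
apply: (can_inj fK); apply: val_inj.
by apply: functional_extensionality_dep => i; exact: cx.
Qed.

(** * Membership in the two classes, and functoriality *)

Lemma IScP_ISP (B : tstructure S) : IScP M B -> ISP M (flat B).
Proof.
move=> [I [phi [D [HD [_ D0 [f [g fg]]]]]]]; exists I, phi, D, HD.
by split=> //; exists f, g.
Qed.

Lemma natext_IScP (A : structure S) : ISP M A -> IScP M (natext M A).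
Proof.
move=> [I [phi [D [HD [[d Dd] [_ [g _]]]]]]].
exists (homset M A), (@projT1 _ _), (@natext_set S J M A),
  (natext_substructure M A); split.
- exact: closed_natext_set.
(* [g] carries a point of the non-empty [D] to an element of [A]. *)
- exists (@evaluation S J M A (g (exist _ d (mem_set Dd)))).
  exact: natext_evaluation.
- by exists (idchom _), (idchom _).
Qed.

(** Serves the functor laws: differently bracketed composites are the same function but carry
    different proofs, so as indices of [x] they must be identified by [hom_ext]. *)
Lemma homset_apply_ext (A : structure S) (x : hom_prod M A) (j : J)
  (f g : hom A (flat (M j))) :
  hom_fun f =1 hom_fun g -> x (existT _ j f) = x (existT _ j g).
Proof. by move=> /hom_ext ->. Qed.

Lemma natext_hom_id (A : structure S) :
  natext_hom M (idhom A) = idchom (natext M A).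
Proof.
apply: chom_ext => x; apply: val_inj.
apply: functional_extensionality_dep => -[j y].
exact: (@homset_apply_ext A (sval x) j (comphom y (idhom A)) y).
Qed.

Lemma natext_hom_comp (A B C : structure S) (u : hom A B) (v : hom B C) :
  natext_hom M (comphom v u) = compchom (natext_hom M v) (natext_hom M u).
Proof.
apply: chom_ext => x; apply: val_inj.
apply: functional_extensionality_dep => -[j y].
exact: (@homset_apply_ext A (sval x) j
  (comphom y (comphom v u)) (comphom (comphom y v) u)).
Qed.

Lemma natext_hom_unit (A B : structure S) (u : hom A B) (a : A) :
  natext_hom M u (unit_hom M A a) = unit_hom M B (u a).
Proof. exact: val_inj. Qed.

End NaturalExtension.

Theorem theorem3p7 (S : signature) (J : Type) (M : J -> tstructure S)
    (M_compact : forall j, compact [set: M j])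
    (M_hausdorff : forall j, hausdorff_space (M j)) :
  (* (i) *)
  (forall B : tstructure S, IScP M B ->
     exists gamma : chom (natext M (flat B)) B,
       forall b : B, gamma (unit_hom M (flat B) b) = b)
  /\
  (* (ii) *)
  [/\ (forall B : tstructure S, IScP M B -> ISP M (flat B)),
      (forall A : structure S, ISP M A -> IScP M (natext M A)),
      [/\ (forall A : structure S, ISP M A ->
             natext_hom M (idhom A) = idchom (natext M A)),
          (forall A B C : structure S, ISP M A -> ISP M B -> ISP M C ->
             forall (u : hom A B) (v : hom B C),
             natext_hom M (comphom v u) =
             compchom (natext_hom M v) (natext_hom M u))
        & (forall A B : structure S, ISP M A -> ISP M B ->
             forall (u : hom A B) (a : A),
             natext_hom M u (unit_hom M A a) = unit_hom M B (u a))]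
    & (forall (A : structure S) (B : tstructure S), ISP M A -> IScP M B ->
         forall g : hom A (flat B),
         exists! h : chom (natext M A) B,
           forall a : A, h (unit_hom M A a) = g a)].
Proof.
split=> [B SB|]; first exact: (natext_extend SB (idhom (flat B))).
split.
- exact: IScP_ISP.
- exact: natext_IScP.
- by split=> *; [exact: natext_hom_id | exact: natext_hom_comp
    | exact: natext_hom_unit].
- move=> A B _ SB g; have [h hg] := natext_extend SB g.
  exists h; split=> // h' h'g; apply: natext_unique => // a.
  by rewrite hg h'g.
Qed.
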